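(* Let $(X,p)$ be a complete partial metric space. Suppose that the mapping $F : X\times X \rightarrow X$ satisfies, for all $x,y,u,v\in X$, \[ p(F(x,y),F(u,v))\leq k\,p(F(x,y),u)+l\,p(F(u,v),x), \] where $k,l$ are nonnegative real constants with $k+2l<1$. Then $F$ has a unique coupled fixed point.
   Context: A partial metric on a nonempty set $X$ is a function $p:X\times X\to[0,+\infty)$ such that for all $x,y,z\in X$: (p1) $x=y$ if and only if $p(x,x)=p(x,y)=p(y,y)$; (p2) $p(x,x)\leq p(x,y)$; (p3) $p(x,y)=p(y,x)$; (p4) $p(x,y)\leq p(x,z)+p(z,y)-p(z,z)$. A partial metric space is a pair $(X,p)$ with $X$ a nonempty set and $p$ a partial metric on $X$. A sequence $\{x_n\}$ in $X$ converges to $x\in X$ if $p(x,x)=\lim_{n\to+\infty}p(x,x_n)$. A sequence $\{x_n\}$ is Cauchy if $\lim_{n,m\to+\infty}p(x_n,x_m)$ exists and is finite. $(X,p)$ is complete if every Cauchy sequence $\{x_n\}$ in $X$ converges to a point $x\in X$ with $p(x,x)=\lim_{n,m\to+\infty}p(x_n,x_m)$. A coupled fixed point of $F:X\times X\to X$ is an element $(x,y)\in X\times X$ with $F(x,y)=x$ and $F(y,x)=y$. *)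

(* Defs.v *)
From mathcomp Require Import all_boot all_order all_algebra.
From mathcomp Require Import boolp classical_sets reals topology normedtype sequences.
Set Implicit Arguments.
Unset Strict Implicit.
Unset Printing Implicit Defensive.
Import Order.TTheory GRing.Theory Num.Theory.
Import numFieldNormedType.Exports.
Local Open Scope classical_set_scope.
Local Open Scope ring_scope.

Record partial_metric (R : realType) (X : Type) (p : X -> X -> R) : Prop := {
  pm_ge0 : forall x y, 0 <= p x y;
  pm_eqP : forall x y, x = y <-> p x x = p x y /\ p x y = p y y;
  pm_self : forall x y, p x x <= p x y;
  pm_sym : forall x y, p x y = p y x;
  pm_triangle : forall x y z, p x y <= p x z + p z y - p z z
}.

Definition pm_cvg (R : realType) (X : Type) (p : X -> X -> R)
    (u : nat -> X) (x : X) : Prop :=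
  p x (u n) @[n --> \oo] --> p x x.

(* The double limit is along the product filter: both indices tend to infinity
   independently. Its value lies in [R], hence is finite. *)
Definition pm_cauchy (R : realType) (X : Type) (p : X -> X -> R)
    (u : nat -> X) : Prop :=
  exists L : R, p (u nm.1) (u nm.2) @[nm --> (\oo, \oo)] --> L.

Definition pm_complete (R : realType) (X : Type) (p : X -> X -> R) : Prop :=
  forall u : nat -> X, pm_cauchy p u ->
    exists x : X,
      pm_cvg p u x /\ p (u nm.1) (u nm.2) @[nm --> (\oo, \oo)] --> p x x.

Definition coupled_fixed_point (X : Type) (F : X -> X -> X) (z : X * X) : Prop :=
  F z.1 z.2 = z.1 /\ F z.2 z.1 = z.2.

(* Main.v *)
Require Import Defs.
From mathcomp Require Import all_boot all_order all_algebra.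
From mathcomp Require Import boolp classical_sets reals topology normedtype sequences.
From mathcomp Require Import lra.
Set Implicit Arguments.
Unset Strict Implicit.
Unset Printing Implicit Defensive.
Import Order.TTheory GRing.Theory Num.Theory.
Import numFieldNormedType.Exports.
Local Open Scope classical_set_scope.
Local Open Scope ring_scope.

(** The contractive condition does not mention the second arguments [y] and [v]
    on its right-hand side, so the two coordinates of a coupled fixed point
    decouple, and it suffices to iterate the diagonal map [a |-> F a a].

    Along an orbit [u] of that map, the condition applied to consecutive terms
    bounds [p (u n.+1) (u n.+2)] by
    [k * p (u n.+1) (u n.+1) + l * p (u n.+2) (u n)].  Small self-distances and
    the triangle inequality turn this into the geometric decay
    [(1 - l) * p (u n.+1) (u n.+2) <= (k + l) * p (u n) (u n.+1)], and the
    ratio [(k + l) / (1 - l)] is less than 1 exactly because [k + 2 * l < 1]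
    ([diagonal_orbit_decay]).  As in a metric space, geometric decay makes all
    the distances [p (u n) (u m)] tend to 0, so completeness gives a limit [x]
    of self-distance 0 ([geometric_steps_cvg]).  Comparing [F x x] with
    [u n.+1 = F (u n) (u n)] and passing to the limit yields
    [p (F x x) x <= k * p (F x x) x]; hence this distance vanishes, and
    [(x, x)] is a coupled fixed point.

    For uniqueness, if [F x y = x] and [F u v = u], then the condition reads
    [p x u <= (k + l) * p x u], whatever [y] and [v] are; this forces
    [p x u = 0], and applies to the first and to the second coordinates of two
    coupled fixed points. *)

Lemma pm_eq0 (R : realType) (X : Type) (p : X -> X -> R) :
  partial_metric p -> forall x y, p x y <= 0 -> x = y.
Proof.
move=> pm x y pxy; apply/(pm_eqP pm).
have := pm_ge0 pm x x; have := pm_ge0 pm y y; have := pm_self pm x y.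
have := pm_self pm y x; rewrite (pm_sym pm y x); have := pm_ge0 pm x y.
by split; lra.
Qed.

Lemma pm_triangle_le (R : realType) (X : Type) (p : X -> X -> R) :
  partial_metric p -> forall x y z, p x y <= p x z + p z y.
Proof.
by move=> pm x y z; have := pm_triangle pm x y z; have := pm_ge0 pm z z; lra.
Qed.

Section GeometricSteps.
Variables (R : realType) (X : Type) (p : X -> X -> R) (u : nat -> X) (r : R).
Hypotheses (pm : partial_metric p) (r_ge0 : 0 <= r) (r_lt1 : r < 1).
Hypothesis step : forall n, p (u n.+1) (u n.+2) <= r * p (u n) (u n.+1).

Lemma step_le_geometric n : p (u n) (u n.+1) <= p (u 0%N) (u 1%N) * r ^+ n.
Proof.
elim: n => [|n IH]; first by rewrite expr0 mulr1.
by apply: le_trans (step n) _; rewrite exprS mulrCA ler_wpM2l.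
Qed.

(** The tail of the geometric series bounds the distances after index [n]; the
    factor [1 - r] replaces the division by [1 - r] in its sum. *)
Lemma dist_le_geometric n j :
  (1 - r) * p (u n) (u (n + j)%N) <= p (u 0%N) (u 1%N) * r ^+ n.
Proof.
elim: j n => [|j IH] n.
  rewrite addn0; apply: le_trans (step_le_geometric n).
  have := pm_self pm (u n) (u n.+1); have := pm_ge0 pm (u n) (u n).
  by move: r_ge0; nra.
have := IH n.+1; rewrite addSnnS exprS => tail.
have tri : (1 - r) * p (u n) (u (n + j.+1)%N)
    <= (1 - r) * (p (u n) (u n.+1) + p (u n.+1) (u (n + j.+1)%N)).
  by rewrite ler_wpM2l ?pm_triangle_le // subr_ge0 ltW.
have : (1 - r) * p (u n) (u n.+1) <= (1 - r) * (p (u 0%N) (u 1%N) * r ^+ n).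
  by rewrite ler_wpM2l ?step_le_geometric // subr_ge0 ltW.
by lra.
Qed.

(** The two indices play symmetric roles here, so that no order between them
    has to be tracked when passing to the double limit. *)
Lemma dist_le_geometric_sym n m :
  p (u n) (u m) <= p (u 0%N) (u 1%N) / (1 - r) * (r ^+ n + r ^+ m).
Proof.
have r1_gt0 : 0 < 1 - r by rewrite subr_gt0.
rewrite mulrAC ler_pdivlMr // mulrC mulrDr.
have pos i : 0 <= p (u 0%N) (u 1%N) * r ^+ i.
  by rewrite mulr_ge0 ?exprn_ge0 // (pm_ge0 pm).
wlog nm : n m / (n <= m)%N.
  move=> H; case: (leqP n m) => [|/ltnW] nm; first exact: H.
  by rewrite (pm_sym pm) [leRHS]addrC; exact: H.
by have := dist_le_geometric n (m - n); rewrite subnKC //; have := pos m; lra.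
Qed.

Lemma double_dist_cvg0 : p (u nm.1) (u nm.2) @[nm --> (\oo, \oo)] --> 0.
Proof.
set C := p (u 0%N) (u 1%N) / (1 - r).
have r_cvg : r ^+ n @[n --> \oo] --> 0 by apply: cvg_expr; rewrite ger0_norm.
apply: (@squeeze_cvgr _ _ _ _ (fun=> 0)
  (fun nm : nat * nat => C * (r ^+ nm.1 + r ^+ nm.2))).
- by apply: nearW => nm; rewrite (pm_ge0 pm) dist_le_geometric_sym.
- exact: cvg_cst.
rewrite -[X in _ --> X](mulr0 C) -[X in C * X](addr0 0).
apply: cvgMl_tmp; apply: cvgD.
  exact: (cvg_comp _ _ cvg_fst r_cvg).
exact: (cvg_comp _ _ cvg_snd r_cvg).
Qed.

Lemma geometric_steps_cvg : pm_complete p ->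
  exists x, p x x = 0 /\ p x (u n) @[n --> \oo] --> 0.
Proof.
move=> cplt; have [|x [ux pxx]] := cplt u; first by exists 0; exact: double_dist_cvg0.
have px0 : p x x = 0 by apply: cvg_unique pxx double_dist_cvg0.
by exists x; split=> //; move: ux; rewrite /pm_cvg px0.
Qed.

End GeometricSteps.

Section Contraction.
Variables (R : realType) (X : Type) (p : X -> X -> R) (F : X -> X -> X).
Variables k l : R.
Hypotheses (pm : partial_metric p) (k_ge0 : 0 <= k) (l_ge0 : 0 <= l).
Hypothesis kl_lt1 : k + 2 * l < 1.
Hypothesis F_contr : forall x y u v : X,
  p (F x y) (F u v) <= k * p (F x y) u + l * p (F u v) x.

Lemma diagonal_orbit_decay a :
  p (F a a) (F (F a a) (F a a)) <= (k + l) / (1 - l) * p a (F a a).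
Proof.
set b := F a a; set c := F b b.
have l1_gt0 : 0 < 1 - l by move: k_ge0 l_ge0 kl_lt1; lra.
rewrite mulrAC ler_pdivlMr //.
have contr : p b c <= k * p b b + l * p c a := F_contr a a b b.
have self : k * p b b <= k * p a b.
  by rewrite ler_wpM2l // (pm_sym pm a b) (pm_self pm).
have tri : l * p c a <= l * (p b c + p a b).
  by rewrite ler_wpM2l // (pm_sym pm b c) (pm_sym pm a b) pm_triangle_le.
by lra.
Qed.

Lemma first_coordinate_unique x y u v : F x y = x -> F u v = u -> x = u.
Proof.
move=> Fx Fu; apply: (pm_eq0 pm).
have := F_contr x y u v; rewrite Fx Fu (pm_sym pm u x).
have := pm_ge0 pm x u; move: l_ge0 kl_lt1; nra.
Qed.

Lemma diagonal_fixed_point : inhabited X -> pm_complete p ->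
  exists x, F x x = x.
Proof.
move=> [x0] cplt; pose u n := iter n (fun a => F a a) x0.
have l1_gt0 : 0 < 1 - l by move: k_ge0 l_ge0 kl_lt1; lra.
have [||x [_ ux]] := @geometric_steps_cvg _ _ _ u ((k + l) / (1 - l)) pm _ _
  (fun n => diagonal_orbit_decay (u n)) cplt.
- by apply: divr_ge0; [exact: addr_ge0 | exact: ltW].
- by rewrite ltr_pdivrMr //; move: kl_lt1; lra.
exists x; apply: (pm_eq0 pm).
have uSx : p x (u n.+1) @[n --> \oo] --> 0 by move: ux; rewrite -(cvg_shiftS _).
(* The terms of the bound below that are free of [P] vanish in the limit. *)
set P := p (F x x) x.
have bound n :
    P <= k * (P + p x (u n)) + l * p x (u n.+1) + p x (u n.+1).
  have contr : p (F x x) (u n.+1) <= k * p (F x x) (u n) + l * p (u n.+1) x.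
    exact: F_contr.
  have tri1 : P <= p (F x x) (u n.+1) + p (u n.+1) x by exact: pm_triangle_le.
  have tri2 : k * p (F x x) (u n) <= k * (P + p x (u n)).
    by rewrite ler_wpM2l // pm_triangle_le.
  by move: contr tri1; rewrite (pm_sym pm (u n.+1) x); lra.
have bound_cvg : k * (P + p x (u n)) + l * p x (u n.+1) + p x (u n.+1)
    @[n --> \oo] --> k * (P + 0) + l * 0 + 0.
  apply: cvgD (uSx); apply: cvgD; apply: cvgMl_tmp; last exact: uSx.
  by apply: cvgD ux; exact: cvg_cst.
have PkP : P <= k * (P + 0) + l * 0 + 0.
  exact: (cvgr_to_ge bound_cvg (nearW _ bound)).
by move: PkP l_ge0 kl_lt1; nra.
Qed.

End Contraction.

Theorem theorem2p5 (R : realType) (X : Type) (p : X -> X -> R)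
    (X_nonempty : inhabited X)
    (p_pm : partial_metric p) (p_complete : pm_complete p)
    (F : X -> X -> X) (k l : R)
    (k_ge0 : 0 <= k) (l_ge0 : 0 <= l) (kl_lt1 : k + 2 * l < 1)
    (F_contr : forall x y u v : X,
      p (F x y) (F u v) <= k * p (F x y) u + l * p (F u v) x) :
  exists! z : X * X, coupled_fixed_point F z.
Proof.
have [x Fxx] :=
  diagonal_fixed_point p_pm k_ge0 l_ge0 kl_lt1 F_contr X_nonempty p_complete.
have uniq := first_coordinate_unique p_pm l_ge0 kl_lt1 F_contr Fxx.
exists (x, x); split=> [|[u v] [/= Fuv Fvu]]; first by [].
by rewrite -(uniq _ _ Fuv) -(uniq _ _ Fvu).
Qed.
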